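(* For every positive integer $n$, during a complete run of $\mathrm{RuleAsc}(n)$, the write statements executed after initialisation are ''$a_k\leftarrow x$'' (inside the inner loop) and ''$a_k\leftarrow x+y$''. Together they are executed a total of exactly $2p(n)-1$ times.
   Context: $p(n)$ denotes the number of partitions of $n$. The procedure $\mathrm{RuleAsc}(n)$, for $n>0$, operates on an array $a$ as follows and visits every ascending composition of $n$ (a sequence of positive integers in nondecreasing order summing to $n$) exactly once, in lexicographic order: 1. Initialisation: $k\leftarrow 2$; $a_1\leftarrow 0$; $a_2\leftarrow n$. 2. While $k\ne 1$: - $y\leftarrow a_k-1$; $k\leftarrow k-1$; $x\leftarrow a_k+1$. - While $x\le y$: $a_k\leftarrow x$; $y\leftarrow y-x$; $k\leftarrow k+1$. - $a_k\leftarrow x+y$; visit $\langle a_1,\dots,a_k\rangle$. *)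

(* Defs.v *)
From HB Require Import structures.
From mathcomp Require Import all_boot.

Set Implicit Arguments.
Unset Strict Implicit.
Unset Printing Implicit Defensive.

Definition is_partition (n : nat) (s : seq nat) : bool :=
  [&& sorted geq s, all (leq 1) s & sumn s == n].

(* A partition of n has at most n parts, each at most n, so bounding the length
   and the entries by n loses nothing and makes the set finite. *)
Definition p (n : nat) : nat :=
  #|[set s : n.-bseq 'I_n.+1 | is_partition n [seq val i | i <- s]]|.

(* The pseudocode is embedded as syntax, so that "the statement a_k <- x is
   executed" can be counted in the list of executed instructions. *)

Inductive reg := K | X | Y.

Inductive expr :=
  | Lit of nat
  | Reg of reg
  | Arr of expr              (* Arr e reads a_e *)
  | Add of expr & expr
  | Sub of expr & expr.

Inductive test :=
  | Neq of expr & expr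
  | Leq of expr & expr.

Inductive instr :=
  | Assign of reg & expr
  | Store of expr & expr     (* Store e v is a_e <- v *)
  | Visit of expr.           (* Visit e visits <a_1, ..., a_e> *)

Inductive cmd :=
  | Do of instr
  | Seq of cmd & cmd
  | While of test & cmd.

Coercion Lit : nat >-> expr.
Coercion Reg : reg >-> expr.
Coercion Do : instr >-> cmd.

Notation "c1 ;; c2" := (Seq c1 c2) (at level 90, right associativity).

Lemma reg_eq_dec (r1 r2 : reg) : decidable (r1 = r2).
Proof. by rewrite /decidable; decide equality. Defined.
HB.instance Definition _ := hasDecEq.Build reg (compareP reg_eq_dec).

Lemma expr_eq_dec (e1 e2 : expr) : decidable (e1 = e2).
Proof.
by rewrite /decidable; decide equality; [exact: eq_comparable | exact: reg_eq_dec].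
Defined.
HB.instance Definition _ := hasDecEq.Build expr (compareP expr_eq_dec).

Lemma instr_eq_dec (i1 i2 : instr) : decidable (i1 = i2).
Proof.
by rewrite /decidable; decide equality;
  solve [exact: expr_eq_dec | exact: reg_eq_dec].
Defined.
HB.instance Definition _ := hasDecEq.Build instr (compareP instr_eq_dec).

Record state := State { arr : nat -> nat; regs : reg -> nat }.

(* Sub is truncated, but RuleAsc never truncates: y - x is guarded by x <= y,
   k - 1 by k <> 1 with k >= 1, and a_k - 1 is only evaluated when a_k is n or
   the last written x + y, with x >= 1. *)
Fixpoint eval (s : state) (e : expr) : nat :=
  match e with
  | Lit m => m
  | Reg r => regs s r
  | Arr e1 => arr s (eval s e1)
  | Add e1 e2 => eval s e1 + eval s e2
  | Sub e1 e2 => eval s e1 - eval s e2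
  end.

Definition holds (s : state) (t : test) : bool :=
  match t with
  | Neq e1 e2 => eval s e1 != eval s e2
  | Leq e1 e2 => eval s e1 <= eval s e2
  end.

Definition step (i : instr) (s : state) : state :=
  match i with
  | Assign r e =>
      State (arr s) (fun q => if q == r then eval s e else regs s q)
  | Store e v =>
      State (fun j => if j == eval s e then eval s v else arr s j) (regs s)
  | Visit _ => s
  end.

(* exec c s tr s': started in s, c terminates in s', and tr lists the executed
   instructions in order. *)
Inductive exec : cmd -> state -> seq instr -> state -> Prop :=
  | ExecDo i s : exec (Do i) s [:: i] (step i s)
  | ExecSeq c1 c2 s1 s2 s3 tr1 tr2 :
      exec c1 s1 tr1 s2 -> exec c2 s2 tr2 s3 ->
      exec (Seq c1 c2) s1 (tr1 ++ tr2) s3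
  | ExecWhileF t c s : ~~ holds s t -> exec (While t c) s [::] s
  | ExecWhileT t c s1 s2 s3 tr1 tr2 :
      holds s1 t -> exec c s1 tr1 s2 -> exec (While t c) s2 tr2 s3 ->
      exec (While t c) s1 (tr1 ++ tr2) s3.

Definition RuleAsc_init (n : nat) : cmd :=
  Assign K 2 ;; Store 1 0 ;; Store 2 n.

Definition write_x : instr := Store K X.
Definition write_xy : instr := Store K (Add X Y).

Definition RuleAsc_main : cmd :=
  While (Neq K 1) (
    Assign Y (Sub (Arr K) 1) ;;
    Assign K (Sub K 1) ;;
    Assign X (Add (Arr K) 1) ;;
    While (Leq X Y) (
      write_x ;;
      Assign Y (Sub Y X) ;;
      Assign K (Add K 1)) ;;
    write_xy ;;
    Visit K).

(* A complete run of RuleAsc(n) from an arbitrary initial memory s0 (the array is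
   not assumed to be cleared); tr is the part of the trace after initialisation. *)
Definition complete_run (n : nat) (s0 : state) (tr : seq instr) : Prop :=
  exists tr0 s1 s2,
    exec (RuleAsc_init n) s0 tr0 s1 /\ exec RuleAsc_main s1 tr s2.

Definition is_store (i : instr) : bool := if i is Store _ _ then true else false.

(* Main.v *)
Require Import Defs.
From mathcomp Require Import all_boot.
From mathcomp Require Import zify.

(** Entering the inner loop with registers k, x, y, the program visits all
    ascending compositions of x + y with parts at least x (behind the fixed
    prefix a_1 ... a_(k-1)), and then sits again at position k with a_k = x + y.
    Indeed, if x <= y, it first appends to the part x all compositions of y with
    parts at least x, and then resumes with x + 1, y - 1 at the same position;
    if y < x, the only composition is x + y itself.  By the same recursion the
    number w of writes satisfies w + 1 = 2 N, N being the number of compositions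
    visited: w = 1 for y < x, and w = 1 + w1 + w2 when N = N1 + N2. *)

Lemma exec_seq_inv c1 c2 s tr s' : exec (Seq c1 c2) s tr s' ->
  exists tr1 s1 tr2,
    [/\ tr = tr1 ++ tr2, exec c1 s tr1 s1 & exec c2 s1 tr2 s'].
Proof. by move=> E; inversion E; subst; do 3! eexists; split; eauto. Qed.

Lemma exec_while_inv t c s tr s' : exec (While t c) s tr s' ->
  if holds s t then exists tr1 s1 tr2,
    [/\ tr = tr1 ++ tr2, exec c s tr1 s1 & exec (While t c) s1 tr2 s']
  else tr = [::] /\ s' = s.
Proof.
move Ec: (While t c) => w E; case: E Ec => //.
  by move=> t' c' s1 Ht [-> _]; rewrite (negPf Ht).
move=> t' c' s1 s2 s3 tr1 tr2 Ht E1 E2 [-> ->]; rewrite Ht.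
by exists tr1, s2, tr2.
Qed.

(** Determinism reduces the claim about every complete run to the exhibition of a single one. *)
Lemma exec_det c s tr1 s1 tr2 s2 :
  exec c s tr1 s1 -> exec c s tr2 s2 -> tr1 = tr2 /\ s1 = s2.
Proof.
move=> E; elim: E tr2 s2 => {c s tr1 s1}.
- by move=> i s tr2 s2 E; inversion E.
- move=> c1 c2 s1 s2 s3 tr1 tr2 _ IH1 _ IH2 tr s.
  by case/exec_seq_inv=> tr1' [s2' [tr2' [-> /IH1[-> <-] /IH2[-> ->]]]].
- by move=> t c s Ht tr s' /exec_while_inv; rewrite (negPf Ht) => -[-> ->].
- move=> t c s1 s2 s3 tr1 tr2 Ht _ IH1 _ IH2 tr s /exec_while_inv; rewrite Ht.
  by case=> tr1' [s2' [tr2' [-> /IH1[-> <-] /IH2[-> ->]]]].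
Qed.

Lemma exec_do_seq i c s tr s' :
  exec c (step i s) tr s' -> exec (Seq (Do i) c) s (i :: tr) s'.
Proof. by rewrite -cat1s; apply: ExecSeq; apply: ExecDo. Qed.

Definition load_y : instr := Assign Y (Defs.Sub (Arr K) 1).
Definition dec_k : instr := Assign K (Defs.Sub K 1).
Definition load_x : instr := Assign X (Add (Arr K) 1).
Definition dec_y : instr := Assign Y (Defs.Sub Y X).
Definition inc_k : instr := Assign K (Add K 1).

Definition inner_body : cmd := write_x ;; dec_y ;; inc_k.

(** What remains of an outer iteration once [y], [k] and [x] are loaded; the recursion is anchored
    at this point. *)
Definition outer_tail : cmd :=
  While (Leq X Y) inner_body ;; write_xy ;; Visit K.

Lemma exec_inner_iteration s tr s1 tr' s2 :
  regs s X <= regs s Y -> exec inner_body s tr s1 ->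
  exec (outer_tail ;; RuleAsc_main) s1 tr' s2 ->
  exec (outer_tail ;; RuleAsc_main) s (tr ++ tr') s2.
Proof.
move=> Ht E1 /exec_seq_inv[tr2 [s3 [tr3 [-> /exec_seq_inv]]]].
case=> tr4 [s4 [tr5 [-> E4 E5]]] E3.
rewrite !catA; apply: ExecSeq E3; rewrite -catA catA; apply: ExecSeq E5.
exact: ExecWhileT E1 E4.
Qed.

Lemma exec_outer_iteration s tr s' :
  regs s K != 1 ->
  exec (outer_tail ;; RuleAsc_main) (step load_x (step dec_k (step load_y s))) tr s' ->
  exec RuleAsc_main s ([:: load_y; dec_k; load_x] ++ tr) s'.
Proof.
move=> Ht /exec_seq_inv[tr1 [s1 [tr2 [-> E1 E2]]]].
rewrite catA; apply: ExecWhileT E2 => //.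
by do 3! apply: exec_do_seq.
Qed.

Definition writes (tr : seq instr) : nat :=
  count_mem write_x tr + count_mem write_xy tr.

Definition stores_ok (tr : seq instr) : bool :=
  all (fun i => is_store i ==> (i == write_x) || (i == write_xy)) tr.

Lemma writes_cat tr1 tr2 : writes (tr1 ++ tr2) = writes tr1 + writes tr2.
Proof. by rewrite /writes !count_cat addnACA. Qed.

Lemma stores_ok_cat tr1 tr2 :
  stores_ok (tr1 ++ tr2) = stores_ok tr1 && stores_ok tr2.
Proof. exact: all_cat. Qed.

(** Starting the path at [x] encodes at once that [s] is nondecreasing and that its parts are at
    least [x]. *)
Definition enumerates (L : seq (seq nat)) (x m : nat) : Prop :=
  uniq L /\ forall s, (s \in L) = path leq x s && (sumn s == m).

Lemma leq_sumn (x : nat) (s : seq nat) : x \in s -> x <= sumn s.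
Proof.
elim: s => //= y s IH; rewrite inE => /orP[/eqP->|/IH]; first exact: leq_addr.
by move=> h; apply: leq_trans h (leq_addl _ _).
Qed.

Lemma enumerates_single x y : y < x -> enumerates [:: [:: x + y]] x (x + y).
Proof.
move=> lt_yx; split=> // s; rewrite inE.
case: s => [|a [|b s]] /=; first by apply/idP/idP => // /eqP; lia.
  rewrite addn0 andbT; apply/eqP/andP=> [[->]|[_ /eqP->]] //.
  by split; [exact: leq_addr|].
by rewrite eqseq_cons andbF; apply/esym/negP=> /andP[/and3P[xa ab _] /eqP]; lia.
Qed.

(** The two sublists separate the compositions by whether the first part equals [x] or exceeds
    it. *)
Lemma enumerates_step L1 L2 x y : 0 < x -> x <= y ->
  enumerates L1 x y -> enumerates L2 x.+1 (x + y) ->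
  enumerates ([seq x :: s | s <- L1] ++ L2) x (x + y).
Proof.
move=> x0 xy [U1 M1] [U2 M2]; have inj : injective (cons x) by move=> s t [].
split.
  rewrite cat_uniq map_inj_uniq // U1 U2 andbT /=.
  by apply/hasPn => s; rewrite M2; case: s => [|a s] //=; rewrite -?andbA;
    [move=> /eqP; lia | move=> /andP[xa _]; apply/mapP => -[t _ [eax _]]; lia].
case=> [|a s]; rewrite mem_cat M2 /=.
  rewrite (_ : 0 == x + y = false) ?orbF; last by lia.
  by apply/mapP => -[].
have [->|ne] := eqVneq a x.
  by rewrite mem_map // M1 leqnn ltnn eqn_add2l orbF.
rewrite ltn_neqAle eq_sym ne /=.
by case: mapP => // -[t _ [eax _]]; rewrite eax eqxx in ne.
Qed.

(** Reversal is a bijection from partitions, written in nonincreasing order, to ascending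
    compositions. *)
Lemma card_partitions L n : enumerates L 1 n -> p n = size L.
Proof.
move=> [U M]; pose f (b : n.-bseq 'I_n.+1) := rev [seq val i | i <- b].
have f_inj : injective f.
  move=> b c /(can_inj revK) /(inj_map val_inj); exact: val_inj.
have part_f (b : n.-bseq 'I_n.+1) : is_partition n [seq val i | i <- b] =
    path leq 1 (f b) && (sumn (f b) == n).
  rewrite path_sortedE; last exact: leq_trans.
  rewrite /is_partition /f rev_sorted all_rev sumn_rev -andbA andbCA.
  by congr andb.
rewrite /p cardE -(size_map f); apply/perm_size/uniq_perm => //.
  by rewrite map_inj_uniq // enum_uniq.
move=> s; rewrite M; apply/mapP/idP => [[b]|].
  by rewrite mem_enum inE part_f => h ->.
move=> hs; have /andP[ps /eqP sn] := hs.
(* The parts are positive, so there are at most as many as their sum. *)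
have sz : size (map (@inord n) (rev s)) <= n.
  rewrite size_map size_rev -sn.
  have := ps; rewrite path_sortedE; last exact: leq_trans.
  case/andP => + _; elim: (s) => //= a t IH /andP[a0 /IH]; lia.
(* Each part is at most the sum [n], so [inord] keeps its value. *)
have fb : f (Bseq sz) = s.
  rewrite /f /= -map_comp -[RHS]revK; congr rev; rewrite -[RHS]map_id.
  apply/eq_in_map => i; rewrite mem_rev => /leq_sumn; rewrite sn => le_in /=.
  by rewrite inordK.
by exists (Bseq sz); rewrite ?mem_enum ?inE ?part_f fb.
Qed.

(** Strong induction on [y]. The segment [tr] starts inside an outer iteration and may span several
    more, so it is not the trace of one command; it is described by what it prepends to any run of
    [RuleAsc_main]. Preservation below [k] lets the induction recover [a_k = x] after the first
    recursive segment. *)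
Lemma run_outer_tail y x k s : 0 < x -> 0 < k ->
  regs s K = k -> regs s X = x -> regs s Y = y ->
  exists L tr s',
    [/\ enumerates L x (x + y), stores_ok tr & (writes tr).+1 = 2 * size L] /\
    [/\ regs s' K = k, arr s' k = x + y, forall j, j < k -> arr s' j = arr s j &
        forall tr2 s2, exec RuleAsc_main s' tr2 s2 ->
          exec (outer_tail ;; RuleAsc_main) s (tr ++ tr2) s2].
Proof.
elim/ltn_ind: y x k s => y IH x k s x0 k0 sK sX sY.
have [xy|yx] := leqP x y; last first.
  exists [:: [:: x + y]], [:: write_xy; Visit K], (step write_xy s).
  split; split.
  - exact: enumerates_single.
  - by [].
  - by [].
  - exact: sK.
  - by rewrite /= sK sX sY eqxx.
  - by move=> j jk; rewrite /= sK ltn_eqF.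
  - move=> tr2 s2; apply: ExecSeq.
    rewrite -[[:: _; _]]cat0s; apply: ExecSeq.
      by apply: ExecWhileF; rewrite /= sX sY -ltnNge.
    by apply: exec_do_seq; apply: ExecDo.
pose s1 := step inc_k (step dec_y (step write_x s)).
have E1 : exec inner_body s [:: write_x; dec_y; inc_k] s1.
  by do 2! apply: exec_do_seq; apply: ExecDo.
(* The segment for the tails behind the part [x] just stored: [y - x < y] since [0 < x], and
   [x + (y - x) = y]. *)
have [||||||L1 [tr1 [s1' [[en1 ok1 w1] [s1K s1a s1p run1]]]]] :=
  IH (y - x) _ x k.+1 s1 => //; rewrite /= ?sK ?sX ?sY ?addn1 //; first by lia.
rewrite subnKC // in en1 s1a.
(* Now [a_(k+1) = y] and [a_k = x], so the loads give [y - 1], position [k] and [x + 1], with total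
   [x + y] again. *)
pose s2 := step load_x (step dec_k (step load_y s1')).
have s1x : arr s1' k = x by rewrite s1p //= sK eqxx.
have [||||||L2 [tr2 [s2' [[en2 ok2 w2] [s2K s2a s2p run2]]]]] :=
  IH y.-1 _ x.+1 k s2 => //; rewrite /= ?s1K ?subn1 ?s1a ?s1x ?addn1 //; first by lia.
have exy : x.+1 + y.-1 = x + y by lia.
rewrite exy in en2 s2a.
exists ([seq x :: t | t <- L1] ++ L2),
  ([:: write_x; dec_y; inc_k] ++ tr1 ++ [:: load_y; dec_k; load_x] ++ tr2), s2'.
split; split => //.
- exact: enumerates_step.
- by rewrite !stores_ok_cat ok1 ok2.
- have wi : writes [:: write_x; dec_y; inc_k] = 1 by [].
  have wj : writes [:: load_y; dec_k; load_x] = 0 by [].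
  by rewrite !writes_cat wi wj size_cat size_map; lia.
- by move=> j jk; rewrite s2p //= s1p ?(ltnW jk) //= ?sK ?ltn_eqF //; lia.
- move=> tr3 s3 E; rewrite -!catA.
  apply: exec_inner_iteration E1 _; first by rewrite sX sY.
  (* The first segment ends at position [k + 1], which is not 1, so the outer loop goes on. *)
  apply: run1; apply: exec_outer_iteration; last exact: run2.
  by rewrite s1K; lia.
Qed.

(** From [a_1 = 0], [a_2 = n] and [k = 2] the first loads give [x = 1], [y = n - 1], [k = 1]. The
    segment therefore covers all compositions of [n], and its return to [k = 1] stops the outer
    loop. *)
Lemma complete_run_exists n s0 : 0 < n ->
  exists2 tr, complete_run n s0 tr &
    stores_ok tr /\ (writes tr).+1 = 2 * p n.
Proof.
move=> n0; set i1 := Assign K 2; set i2 := Store 1 0; set i3 := Store 2 n.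
pose s1 := step i3 (step i2 (step i1 s0)).
pose s2 := step load_x (step dec_k (step load_y s1)).
have [|||||L [tr [s' [[en ok w] [sK _ _ run]]]]] :=
  @run_outer_tail n.-1 1 1 s2 => //; first by rewrite /= subn1.
rewrite add1n prednK // in en.
exists ([:: load_y; dec_k; load_x] ++ tr ++ [::]).
  exists [:: i1; i2; i3], s1, s'; split.
    by do 2! apply: exec_do_seq; apply: ExecDo.
  apply: exec_outer_iteration => //; apply: run.
  by apply: ExecWhileF; rewrite /= sK.
rewrite cats0 stores_ok_cat writes_cat ok (card_partitions _ _ en) -w.
by [].
Qed.

Theorem theorem3p8 (n : nat) (hn : 0 < n) (s0 : state) :
  (exists tr : seq instr, complete_run n s0 tr) /\
  (forall tr : seq instr, complete_run n s0 tr ->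
     (forall i : instr, i \in tr -> is_store i ->
        i = write_x \/ i = write_xy) /\
     count_mem write_x tr + count_mem write_xy tr = 2 * p n - 1).
Proof.
have [tr run [ok w]] := complete_run_exists n s0 hn.
split; first by exists tr.
move=> tr' [tr0' [s1' [s2' [I' M']]]].
case: run => tr0 [s1 [s2 [I M]]].
(* Both initialisations start in [s0], hence end in the same state; only then can the two main
   traces be compared. *)
have [_ e] := exec_det _ _ _ _ _ _ I I'; subst s1'.
have [e _] := exec_det _ _ _ _ _ _ M M'; subst tr'.
split; last by rewrite -w subn1.
move=> i /(allP ok) /implyP h /h /orP[] /eqP ->; by [left | right].
Qed.
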